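(* There is a randomized protocol for testing feasibility of distributed linear systems $Ax=b$ that succeeds with probability at least $0.99$ and has communication complexity $O(sd^2\log(dL))$ in the coordinator model and $O(s + d^2\log(dL))$ in the blackboard model.
   Context: There are $s\ge2$ servers $P_1,\dots,P_s$ and a coordinator. $A\in\mathbb{R}^{n\times d}$ and $b\in\mathbb{R}^n$ have integer entries in $[-2^L,2^L]$ and the rows of $[A~b]$ are partitioned among servers ($P_i$ holds $A^{(i)}x=b^{(i)}$). Feasibility testing: the coordinator must report whether $Ax=b$ has a solution. Coordinator model: servers communicate only with the coordinator through private channels; blackboard model: all messages are broadcast on a shared blackboard. Communication complexity is the total number of bits sent. *)

(* Defs.v *)
From HB Require Import structures.
From mathcomp Require Import all_boot all_order all_algebra.
From mathcomp Require Import boolp reals exp.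

Set Implicit Arguments.
Unset Strict Implicit.
Unset Printing Implicit Defensive.

Import Order.TTheory GRing.Theory Num.Theory.
Local Open Scope ring_scope.

(* The parties are the coordinator, [None], and the servers, [Some i].  Each
   party has private randomness: an independent uniform element of a finite
   type [W].  A joint outcome is [w : {ffun option 'I_s -> W}], because the
   uniform law on that function space is the product of the uniform laws.
   A run returns the reported answer and the total number of bits sent. *)

Section CoordinatorModel.
Variables (s : nat) (X : Type).

(* What the coordinator does once its coins are fixed: report an answer, or
   use channel [i] for one more bit, after which it knows that bit.  In
   [Use i c k], [c] is the bit the coordinator puts on the channel if it is
   its turn to speak there; otherwise the bit comes from server [i]. *)
Inductive strategy : Type :=
  | Report (ans : bool)
  | Use (i : 'I_s) (c : bool) (k : bool -> strategy).

(* [cp_turn i h] says whether, after the bits [h] on channel [i], the next bit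
   there is sent by server [i] (true) or by the coordinator (false).  It depends
   on the transcript of that channel only, so both ends agree on it and no
   information is conveyed by timing.  The next bit of server [i] depends on
   its own input, its own coins, and the transcript of its own channel. *)
Record coord_protocol := CoordProtocol {
  cp_coins : finType;
  cp_turn : 'I_s -> seq bool -> bool;
  cp_server : 'I_s -> X -> cp_coins -> seq bool -> bool;
  cp_coordinator : cp_coins -> strategy }.

Fixpoint coord_exec (P : coord_protocol) (x : 'I_s -> X)
    (w : {ffun option 'I_s -> cp_coins P}) (h : 'I_s -> seq bool)
    (t : strategy) : bool * nat :=
  match t with
  | Report ans => (ans, 0%N)
  | Use i c k =>
      let a := if cp_turn P i (h i)
               then cp_server i (x i) (w (Some i)) (h i) else c in
      let h' := fun j => if j == i then rcons (h j) a else h j in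
      let r := coord_exec x w h' (k a) in
      (r.1, r.2.+1)
  end.

Definition coord_run (P : coord_protocol) (x : 'I_s -> X)
    (w : {ffun option 'I_s -> cp_coins P}) : bool * nat :=
  coord_exec x w (fun=> [::]) (cp_coordinator (w None)).

End CoordinatorModel.

Section BlackboardModel.
Variables (s : nat) (X : Type).

(* A node of the tree stands for the current contents of the blackboard, which
   determine who writes the next bit; the writer also uses its own coins and,
   for a server, its own input. *)
Inductive bb_tree (W : Type) : Type :=
  | BBReport (ans : W -> bool)
  | BBCoordinator (bit : W -> bool) (k : bool -> bb_tree W)
  | BBServer (i : 'I_s) (bit : X -> W -> bool) (k : bool -> bb_tree W).

Record bb_protocol := BBProtocol {
  bb_coins : finType;
  bb_root : bb_tree bb_coins }.

Fixpoint bb_exec (W : finType) (x : 'I_s -> X)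
    (w : {ffun option 'I_s -> W}) (t : bb_tree W) : bool * nat :=
  match t with
  | BBReport ans => (ans (w None), 0%N)
  | BBCoordinator bit k =>
      let r := bb_exec x w (k (bit (w None))) in (r.1, r.2.+1)
  | BBServer i bit k =>
      let r := bb_exec x w (k (bit (x i) (w (Some i)))) in (r.1, r.2.+1)
  end.

Definition bb_run (P : bb_protocol) (x : 'I_s -> X)
    (w : {ffun option 'I_s -> bb_coins P}) : bool * nat :=
  bb_exec x w (bb_root P).

End BlackboardModel.

Definition uniform_prob (R : realType) (T : finType) (E : pred T) : R :=
  #|E|%:R / #|T|%:R.

Definition subsystem (d : nat) : Type := seq ('rV[int]_d * int).

(* Row [j] of [A b] is held by server [part j]; a server sees neither [n] nor
   the global indices of its rows. *)
Definition held_by (s n d : nat) (A : 'M[int]_(n, d)) (b : 'cV[int]_n)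
    (part : 'I_n -> 'I_s) (i : 'I_s) : subsystem d :=
  [seq (row j A, b j ord0) | j <- enum 'I_n & part j == i].

Definition entries_bounded (L n m : nat) (M : 'M[int]_(n, m)) : Prop :=
  forall i j, `|M i j| <= 2 ^+ L.

Definition feasible (R : realType) (n d : nat)
    (A : 'M[int]_(n, d)) (b : 'cV[int]_n) : Prop :=
  exists x : 'cV[R]_d, map_mx intr A *m x = map_mx intr b.

Definition tests_feasibility (R : realType) (s d L : nat) (W : finType)
    (run : ('I_s -> subsystem d) -> {ffun option 'I_s -> W} -> bool * nat)
    (p : R) : Prop :=
  forall (n : nat) (A : 'M[int]_(n, d)) (b : 'cV[int]_n)
         (part : 'I_n -> 'I_s),
    entries_bounded L A -> entries_bounded L b ->
    p <= uniform_prob R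
           [pred w | (run (held_by A b part) w).1 == `[< feasible R A b >]].

(* Worst case over inputs and coins. *)
Definition communication_at_most (R : realType) (s d L : nat) (W : finType)
    (run : ('I_s -> subsystem d) -> {ffun option 'I_s -> W} -> bool * nat)
    (bound : R) : Prop :=
  forall (n : nat) (A : 'M[int]_(n, d)) (b : 'cV[int]_n)
         (part : 'I_n -> 'I_s) (w : {ffun option 'I_s -> W}),
    entries_bounded L A -> entries_bounded L b ->
    (run (held_by A b part) w).2%:R <= bound.

(* log (d L), except that the value at d L = 1 is log 2 and not 0: with the
   literal value a bound such as O(s d^2 log (d L)) would forbid any
   communication when d = L = 1. *)
Definition log_dL (R : realType) (d L : nat) : R := ln (maxn 2 (d * L)%N)%:R.

(* Main.v *)
(* Feasibility is tested modulo a random prime [p] drawn by the coordinator and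
   sent to the servers.  By Cramer's rule, either [A x = D b] or
   [y A = 0, y b = D] has an integral solution for some nonzero minor [D] of
   [A b]; this certificate of (in)feasibility survives modulo [p] unless [p]
   divides [D].  Since [|D| <= (d+1)! 2^(L(d+1))], at most [(d+L)(d+1)] primes
   are bad, and by Chebyshev's estimate there are 100 times as many primes with
   [O(log (dL))] bits.

   Modulo [p], the system is infeasible iff the row (0, ..., 0 | 1) lies in the
   row space of [A b].  With private channels each server sends a matrix
   spanning its own row space.  On the blackboard the servers speak in turn and
   write only rows outside the span of the rows already written, so that at most
   [d+1] rows are ever written. *)

Require Import Defs.
From HB Require Import structures.
From mathcomp Require Import all_boot all_order all_fingroup all_algebra.
From mathcomp Require Import boolp reals exp zify.

Set Implicit Arguments.
Unset Strict Implicit.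
Unset Printing Implicit Defensive.

(** * Chebyshev's lower bound on the number of primes *)

(** Vandermonde's identity writes C(2n,n) as the sum of C(n,j) C(n,n-j), each term of which is at
    least C(n,j). *)
Lemma central_bin_ge n : 2 ^ n <= 'C(n.*2, n).
Proof.
rewrite -addnn -binomial.Vandermonde.
have -> : 2 ^ n = \sum_(j < n.+1) 'C(n, j).
  by rewrite -[2]/(1 + 1) expnDn; apply: eq_bigr => j _; rewrite !exp1n !muln1.
by apply: leq_sum => j _; rewrite leq_pmulr // bin_gt0 leq_subr.
Qed.

Lemma divn_double_le n q : n.*2 %/ q <= (n %/ q).*2 + (q <= n.*2).
Proof.
case: (leqP q n.*2) => [le_qn | lt_nq]; last by rewrite divn_small.
case: q le_qn => [|q] _; first by rewrite !divn0.
rewrite [in X in X <= _](divn_eq n q.+1) doubleD -!muln2 mulnAC divnMDl //.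
rewrite leq_add2l -ltnS ltn_divLR //.
by have := ltn_pmod n (ltn0Sn q); lia.
Qed.

(* By Legendre's formula the exponent of [p] is a sum of terms that are at most
   1, and vanish beyond the integral part of log_p (2n). *)
Lemma central_bin_ppart_le p n : prime p -> 0 < n ->
  p ^ logn p 'C(n.*2, n) <= n.*2.
Proof.
move=> p_pr n_gt0; have p_gt1 := prime_gt1 p_pr.
have n2_gt0 : 0 < n.*2 by rewrite double_gt0.
apply: leq_trans (trunc_logP p_gt1 n2_gt0).
rewrite leq_exp2l //.
have le_n : n <= n.*2 by rewrite -addnn leq_addr.
have /(congr1 (logn p)) := bin_fact le_n.
have -> : n.*2 - n = n by lia.
rewrite !lognM ?muln_gt0 ?fact_gt0 ?bin_gt0 //.
rewrite !logn_fact //.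
(* Padding with zero terms gives the Legendre sums of n! and (2n)! the same range, so that they can
   be compared term by term. *)
have -> : \sum_(1 <= k < n.+1) n %/ p ^ k = \sum_(1 <= k < n.*2.+1) n %/ p ^ k.
  rewrite [RHS](big_cat_nat (n := n.+1)) //= [X in _ = _ + X]big_nat_cond.
  rewrite [X in _ = _ + X]big1 ?addn0 // => k /andP[/andP[nk _] _].
  by rewrite divn_small // (leq_trans nk) // ltnW // ltn_expl.
set t := trunc_log p n.*2 => eqC.
have: \sum_(1 <= k < n.*2.+1) n.*2 %/ p ^ k <=
      \sum_(1 <= k < n.*2.+1) ((n %/ p ^ k).*2 + (k <= t)).
  apply: leq_sum => k _; apply: leq_trans (divn_double_le _ _) _.
  rewrite leq_add2l; case: (leqP (p ^ k)) => // le_pk.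
  by rewrite /t trunc_log_max.
rewrite -{}eqC big_split /=.
under [X in _ <= X + _]eq_bigr do rewrite -addnn.
rewrite big_split /= addnC leq_add2l => /leq_trans; apply.
rewrite -big_mkcond /= -big_filter sum1_size -[leqRHS](size_iota 1 t).
apply: uniq_leq_size; first by rewrite filter_uniq // iota_uniq.
move=> k; rewrite mem_filter mem_index_iota mem_iota add1n ltnS.
by case/and3P=> k_le k_gt0 _; rewrite k_gt0 ltnS.
Qed.

Definition primes_upto N : seq nat := [seq p <- iota 0 N.+1 | prime p].

Lemma mem_primes_upto N p : (p \in primes_upto N) = prime p && (p <= N).
Proof. by rewrite mem_filter mem_iota. Qed.

Lemma primes_upto_uniq N : uniq (primes_upto N).
Proof. by rewrite filter_uniq // iota_uniq. Qed.

Lemma prime_dvdn_fact p n : prime p -> p %| n`! -> p <= n.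
Proof.
move=> p_pr; elim: n => [|n IHn]; first by rewrite dvdn1 => /eqP p1; rewrite p1 in p_pr.
by rewrite factS Euclid_dvdM // => /orP[/dvdn_leq-> // | /IHn/leqW].
Qed.

(** Every prime factor divides (2n)!, hence is at most 2n, and so is the full power with which it
    occurs. *)
Lemma central_bin_le n : 0 < n -> 'C(n.*2, n) <= n.*2 ^ size (primes_upto n.*2).
Proof.
move=> n_gt0; set c := 'C(_, _).
have c_gt0 : 0 < c by rewrite bin_gt0 -addnn leq_addr.
have sub_primes : {subset primes c <= primes_upto n.*2}.
  move=> p; rewrite mem_primes mem_primes_upto => /and3P[p_pr _ p_dv].
  rewrite p_pr; apply: prime_dvdn_fact => //.
  have le_n : n <= n.*2 by rewrite -addnn leq_addr.
  by rewrite -(bin_fact le_n) dvdn_mulr.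
rewrite {1}(prod_prime_decomp c_gt0) prime_decompE big_map /=.
apply: leq_trans (_ : n.*2 ^ size (primes c) <= _); last first.
  by rewrite leq_pexp2l ?double_gt0 // uniq_leq_size // primes_uniq.
rewrite -sum1_size expn_sum big_seq [leqRHS]big_seq.
apply: leq_prod => p; rewrite mem_primes expn1 => /andP[p_pr _].
exact: central_bin_ppart_le.
Qed.

(** Compare exponents of 2 in the two bounds on C(2n,n) for n = 2^e. *)
Lemma size_primes_upto_ge e : 2 ^ e <= e.+1 * size (primes_upto (2 ^ e.+1)).
Proof.
rewrite -(leq_exp2l (m := 2)) // expnM expnS mul2n.
by apply: leq_trans (central_bin_ge _) (central_bin_le _); rewrite expn_gt0.
Qed.

Lemma size_primes_le n : 0 < n -> 2 ^ size (primes n) <= n.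
Proof.
move=> n_gt0; rewrite [leqRHS](prod_prime_decomp n_gt0) prime_decompE big_map /=.
rewrite -sum1_size expn_sum big_seq [leqRHS]big_seq.
apply: leq_prod => p p_n; have := p_n; rewrite mem_primes => /andP[p_pr _].
rewrite expn1 (leq_trans (prime_gt1 p_pr)) // -{1}(expn1 p).
by rewrite leq_pexp2l ?logn_gt0 ?prime_gt0.
Qed.

Import Order.TTheory GRing.Theory Num.Theory.
Local Open Scope ring_scope.

(** * Integral certificates and reduction modulo a prime *)

Lemma det_entries_bound (R : numDomainType) (r : nat) (M : 'M[R]_r) (B : R) :
  (forall i j, `|M i j| <= B) -> `|\det M| <= r`!%:R * B ^+ r.
Proof.
move=> leB; rewrite /determinant (le_trans (ler_norm_sum _ _ _)) //.
apply: le_trans (_ : \sum_(s : 'S_r) B ^+ r <= _).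
  apply: ler_sum => s _; rewrite normrM normrX normrN1 expr1n mul1r normr_prod.
  rewrite -[r in leRHS]card_ord -prodr_const.
  by apply: ler_prod => i _; rewrite normr_ge0 leB.
by rewrite sumr_const card_Sn mulr_natl.
Qed.

Section IntegralSolutions.
Variables (F : numFieldType) (m k : nat) (M : 'M[int]_(m, k)) (c : 'cV[int]_m).
Local Notation "N ^Z" := (map_mx intr N : 'M[F]_(_, _)) (at level 2).

(* Cramer's rule for a nonsingular minor of maximal size. *)
Lemma bounded_integral_solution (B : int) :
    1 <= B -> (forall i j, `|M i j| <= B) ->
    (exists z : 'cV[F]_k, M^Z *m z = c^Z) ->
  exists (z : 'cV[int]_k) (D : int),
    [/\ M *m z = D *: c, D != 0
      & forall r : nat, (m <= r)%N || (k <= r)%N -> `|D| <= r`!%:R * B ^+ r].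
Proof.
move=> B_ge1 leB [z0 Mz0].
pose f := maxrankfun M^Z.
have free_f : row_free (rowsub f M^Z) by exact: maxrowsub_free.
have full_f : row_full (rowsub f M^Z)^T by rewrite /row_full mxrank_tr.
pose g := fullrankfun full_f.
pose N := mxsub f g M.
have detN : \det N != 0.
  have := fullrowsub_unit full_f; rewrite -/g unitmxE unitfE.
  rewrite -trmx_mxsub det_tr; apply: contraNneq => N0.
  have -> : mxsub id g (rowsub f M^Z) = N^Z by apply/matrixP=> i j; rewrite !mxE.
  by rewrite det_map_mx N0 rmorph0.
have injZ (a b : nat) : injective (map_mx intr : 'M[int]_(a, b) -> 'M[F]_(a, b)).
  move=> X Y /matrixP eqXY; apply/matrixP=> i j.
  by have := eqXY i j; rewrite !mxE => /intr_inj.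
(* Cramer's solution on the columns selected by [g], extended by zero to the others. *)
pose z := colsub g (1%:M : 'M[int]_k) *m (\adj N *m rowsub f c).
have fz : rowsub f M *m z = \det N *: rowsub f c.
  rewrite /z mulmxA -[_ *m colsub g _]mxsub_mul mulmx1 -/N mulmxA.
  by rewrite mul_mx_adj mul_scalar_mx.
exists z, (\det N); split=> //.
  (* The other equations follow: [T] expresses all rows of [M] through the selected ones, and c = M
     z0 satisfies the same relations. *)
  have /submxP[T defM] : (M^Z <= rowsub f M^Z)%MS by rewrite eq_maxrowsub.
  have MT (u : 'cV[F]_k) : M^Z *m u = T *m (rowsub f M^Z *m u).
    by rewrite mulmxA -defM.
  apply: injZ; rewrite map_mxM map_mxZ -Mz0 [LHS]MT [in RHS]MT.
  rewrite scalemxAr; congr (_ *m _).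
  have := congr1 (map_mx intr : _ -> 'M[F]_(_, _)) fz.
  rewrite map_mxM map_mxZ !map_mxsub => ->; congr (_ *: _).
  by rewrite -Mz0 [LHS]rowsubE mulmxA -rowsubE.
move=> r le_r; have rk_r : (\rank M^Z <= r)%N.
  by case/orP: le_r => /(leq_trans _)->//; rewrite (rank_leq_row, rank_leq_col).
have /le_trans : `|\det N| <= (\rank M^Z)`!%:R * B ^+ \rank M^Z.
  by apply: det_entries_bound => i j; rewrite mxE.
apply; apply: ler_pM; rewrite ?ler0n ?exprn_ge0 ?(le_trans ler01) //.
  by rewrite ler_nat leq_fact.
by rewrite ler_weXn2l.
Qed.

End IntegralSolutions.

(* The equation 0 = 1, as a row of an augmented matrix [A b]. *)
Definition absurd_row (F : fieldType) (d : nat) : 'rV[F]_(d + 1) := row_mx 0 1.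

(** If b is outside the column space of A, some column of the cokernel of A^T gives y with y A = 0
    and y b nonzero; rescaling makes y b = 1. *)
Lemma fredholm_alternative (F : fieldType) (n d : nat) (A : 'M[F]_(n, d))
    (b : 'cV[F]_n) :
  ~ (exists x, A *m x = b) -> (absurd_row F d <= row_mx A b)%MS.
Proof.
move=> nsol; have : ~~ (b^T <= A^T)%MS.
  apply/negP => /submxP[x defb]; apply: nsol; exists x^T.
  by rewrite -[RHS]trmxK defb trmx_mul trmxK.
rewrite submxE => /matrix0Pn[i [j nz]].
set K := cokermx A^T in nz.
pose y : 'rV_n := (K *m delta_mx j 0)^T.
have yA : y *m A = 0.
  by rewrite -[A]trmxK -trmx_mul mulmxA mulmx_coker mul0mx trmx0.
have yb : y *m b = ((b^T *m K) i j)%:M.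
  rewrite -[in LHS](trmxK b) -trmx_mul mulmxA -colE; apply/matrixP=> p q.
  by rewrite !ord1 !mxE eqxx mulr1n.
set a := _ i j in nz yb.
apply/submxP; exists (a^-1 *: y).
rewrite mul_mx_row -!scalemxAl yA yb scaler0 scale_scalar_mx mulVf //.
Qed.

(** If y A = 0 and y b = 1, then 0 = y A x = D. Keeping the factor D lets an integral certificate be
    reduced modulo p without division. *)
Lemma absurd_row_notin (F : fieldType) (n d : nat) (A : 'M[F]_(n, d))
    (b : 'cV[F]_n) (x : 'cV[F]_d) (D : F) :
  D != 0 -> A *m x = D *: b -> ~~ (absurd_row F d <= row_mx A b)%MS.
Proof.
move=> nzD Ax; apply/negP => /submxP[y].
rewrite mul_mx_row => /eq_row_mx[yA yb].
have : y *m A *m x = D%:M by rewrite -mulmxA Ax -scalemxAr -yb scale_scalar_mx mulr1.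
rewrite -yA mul0mx => /matrixP/(_ 0 0); rewrite !mxE eqxx mulr1n => D0.
by rewrite -D0 eqxx in nzD.
Qed.

Lemma intr_Fp_neq0 (p : nat) (D : int) :
  prime p -> ~~ (p %| `|D|)%N -> D%:~R != 0 :> 'F_p.
Proof.
move=> p_pr; apply: contraNneq => D0.
have pF := pchar_Fp p_pr; rewrite (dvdn_pcharf pF).
by case: D D0 => [q|q] /=; rewrite ?NegzE ?mulrNz ?abszN //= => /eqP; rewrite ?oppr_eq0.
Qed.

(* The witness is the minor of [A b] that certifies feasibility or
   infeasibility over the reals; modulo any prime not dividing it the same
   certificate is still valid. *)
Lemma feasible_mod_prime (R : realType) (n d L : nat) (A : 'M[int]_(n, d))
    (b : 'cV[int]_n) :
    entries_bounded L A -> entries_bounded L b ->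
  exists D : nat, [/\ (0 < D)%N, (D <= (d.+1)`! * (2 ^ L) ^ d.+1)%N
    & forall p, prime p -> ~~ (p %| D)%N ->
      ~~ (absurd_row 'F_p d <= row_mx (map_mx intr A) (map_mx intr b))%MS
        = `[< feasible R A b >]].
Proof.
move=> bndA bndb.
have B1 : 1 <= 2 ^+ L :> int by rewrite exprn_ege1.
have toN (D : int) : `|D| <= (d.+1)`!%:R * (2 ^+ L) ^+ d.+1 ->
    (`|D| <= (d.+1)`! * (2 ^ L) ^ d.+1)%N.
  by rewrite -lez_nat abszE => /le_trans-> //; rewrite PoszM -!natrX !natz.
case: asboolP => [feas | infeas].
  have [x [D [Ax nzD leD]]] := bounded_integral_solution B1 bndA feas.
  exists `|D|%N; split; first by rewrite absz_gt0.
    by apply: toN; apply: leD; rewrite leqnSn orbT.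
  move=> p p_pr pD; apply: (@absurd_row_notin _ _ _ _ _ (map_mx intr x) D%:~R).
    exact: intr_Fp_neq0.
  by rewrite -map_mxM Ax map_mxZ.
pose M := row_mx A b.
have /submxP[y0 y0M] := fredholm_alternative infeas.
pose e : 'rV[int]_(d + 1) := row_mx 0 1.
have eZ (F : fieldType) : map_mx intr e = absurd_row F d.
  by rewrite /e map_row_mx map_mx0 map_mx1.
have bndM i j : `|M^T i j| <= 2 ^+ L.
  by rewrite mxE /M mxE; case: split => k; [apply: bndA | apply: bndb].
(* An infeasibility certificate solves the transposed system; its d+1 equations bound the minor
   independently of n. *)
have sol : exists z : 'cV[R]_n, map_mx intr M^T *m z = map_mx intr e^T.
  exists y0^T; rewrite -!map_trmx eZ y0M trmx_mul; congr (_^T *m _).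
  by rewrite map_row_mx.
have [y [D [My nzD leD]]] := bounded_integral_solution B1 bndM sol.
exists `|D|%N; split; first by rewrite absz_gt0.
  by apply: toN; apply: leD; rewrite addn1 leqnn.
move=> p p_pr pD; apply/negbF/submxP; exists ((D%:~R)^-1 *: (map_mx intr y)^T).
rewrite -map_row_mx -/M -scalemxAl map_trmx -map_mxM.
have -> : y^T *m M = D *: e by rewrite -[LHS]trmxK trmx_mul trmxK My linearZ /= trmxK.
by rewrite map_mxZ eZ scalerA mulVf ?scale1r // intr_Fp_neq0.
Qed.

(** * The protocol with private channels *)

Section FixedLengthCode.
Variables (T : finType) (m : nat).

(** The default word is reached only if [T] has more than 2^m elements. *)
Definition encode (x : T) : m.-tuple bool :=
  nth [tuple of nseq m false] (enum {: m.-tuple bool}) (enum_rank x).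

Definition decode (c : seq bool) : option T := [pick x | encode x == c :> seq bool].

Lemma encodeK : (#|T| <= 2 ^ m)%N -> pcancel encode decode.
Proof.
move=> leT x; rewrite /decode; case: pickP => [y /eqP/val_inj eq_xy | /(_ x)]; last first.
  by rewrite eqxx.
congr Some; apply/enum_rank_inj/val_inj/eqP; move/eqP: eq_xy.
have lt_rank (z : T) : (enum_rank z < size (enum {: m.-tuple bool}))%N.
  by rewrite -cardE card_tuple card_bool (leq_trans _ leT).
by rewrite nth_uniq ?enum_uniq.
Qed.

End FixedLengthCode.

Lemma card_mx_le (T : finType) (m n ell : nat) :
  (#|T| <= 2 ^ ell)%N -> (#|{: 'M[T]_(m, n)}| <= 2 ^ (m * n * ell))%N.
Proof.
move=> leT; rewrite card_mx (mulnC _ ell) (expnM 2).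
by case: (m * n)%N => // k; rewrite leq_exp2r.
Qed.

(** * Row spaces held by the servers *)

Section RowSpan.
Variables (F : fieldType) (d : nat).

(** A square matrix however many rows are held, so its code has a length independent of n. *)
Definition row_span (x : subsystem d) : 'M[F]_(d + 1) :=
  (\sum_(r <- x) <<row_mx (map_mx intr r.1) (intr r.2)%:M>>)%MS.

Lemma row_span_held_by (s n : nat) (A : 'M[int]_(n, d)) (b : 'cV[int]_n)
    (part : 'I_n -> 'I_s) (N : nat) (v : 'M[F]_(N, d + 1)) :
  (v <= \sum_(i <- enum 'I_s) row_span (held_by A b part i))%MS
    = (v <= row_mx (map_mx intr A) (map_mx intr b))%MS.
Proof.
set M := row_mx _ _.
have rowM j : row j M = row_mx (map_mx intr (row j A)) ((b j 0)%:~R)%:M.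
  rewrite /M row_row_mx map_row; congr row_mx.
  by apply/matrixP=> p q; rewrite !ord1 !mxE eqxx mulr1n.
suff -> : (\sum_(i <- enum 'I_s) row_span (held_by A b part i) =
           \sum_j <<row j M>>)%MS.
  apply/idP/idP => /submx_trans; apply.
    by apply/sumsmx_subP => j _; rewrite genmxE row_sub.
  by apply/row_subP => j; apply: (sumsmx_sup j); rewrite ?genmxE.
rewrite [RHS](partition_big part predT) //= big_enum /=; apply: eq_bigr => i _.
rewrite /row_span /held_by big_map big_filter big_enum_cond /=.
by apply: eq_bigr => j _; rewrite rowM.
Qed.

End RowSpan.

Section CoordinatorProtocol.
Variables (s d ell : nat) (W : finType) (F : W -> finFieldType).
Hypothesis card_W : (#|W| <= 2 ^ ell)%N.
Hypothesis card_F : forall w, (#|F w| <= 2 ^ ell)%N.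

Local Notation msg_len := ((d + 1) * (d + 1) * ell)%N.

(** One use of channel [i] per entry of [cs]; an entry is a mere placeholder when the server is to
    speak. The continuation receives the whole transcript. *)
Fixpoint converse (i : 'I_s) (cs acc : seq bool) (k : seq bool -> strategy s) :=
  if cs is c :: cs' then
    Use i c (fun a => converse i cs' (rcons acc a) k)
  else k acc.

Definition span_code (w : W) (x : subsystem d) : seq bool :=
  encode msg_len (row_span (F w) x).

Fixpoint poll (w : W) (l : seq 'I_s) (U : 'M[F w]_(d + 1)) : strategy s :=
  if l is i :: l' then
    converse i (encode ell w ++ nseq msg_len false) [::]
      (fun t => poll l' (U + odflt 0 (decode 'M[F w]_(d + 1) msg_len (drop ell t)))%MS)
  else Report s (~~ (absurd_row (F w) d <= U)%MS).

(** On each channel the first [ell] bits carry the coordinator's choice of prime; the server decodes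
    it and answers with its row space modulo that prime. *)
Definition span_protocol : coord_protocol s (subsystem d) :=
  {| cp_coins := W;
     cp_turn := fun _ h => (ell <= size h)%N;
     cp_server := fun _ x _ h =>
       if decode W ell (take ell h) is Some w
       then nth false (span_code w x) (size h - ell) else false;
     cp_coordinator := fun w => poll (enum 'I_s) (0 : 'M[F w]_(d + 1)) |}.

Let P := span_protocol.

(** The transcript produced by [converse], isolated from the rest of the execution. *)
Fixpoint channel (x : 'I_s -> subsystem d) (w : {ffun option 'I_s -> W}) (i : 'I_s)
    (cs acc : seq bool) : seq bool :=
  if cs is c :: cs' then
    channel x w i cs' (rcons acc
      (if cp_turn P i acc then @cp_server _ _ P i (x i) (w (Some i)) acc else c))
  else acc.

Lemma channel_cat x w i cs1 cs2 acc :
  channel x w i (cs1 ++ cs2) acc = channel x w i cs2 (channel x w i cs1 acc).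
Proof. by elim: cs1 acc => //= c cs1 IH acc; rewrite IH. Qed.

Lemma channel_coordinator x w i cs acc :
  (size acc + size cs <= ell)%N -> channel x w i cs acc = acc ++ cs.
Proof.
elim: cs acc => [|c cs IH] acc /=; first by rewrite cats0.
rewrite addnS => lt_ell; rewrite leqNgt (leq_trans _ lt_ell) ?ltnS ?leq_addr //=.
by rewrite IH ?size_rcons ?addSn // cat_rcons.
Qed.

Lemma channel_server x w i (v : W) k :
  (k <= msg_len)%N ->
  channel x w i (nseq k false) (encode ell v) =
    encode ell v ++ take k (span_code v (x i)).
Proof.
elim: k => [|k IH] lt_k; first by rewrite take0 cats0.
rewrite -addn1 nseqD channel_cat IH ?(ltnW lt_k) //=.
have sz_k : size (take k (span_code v (x i))) = k.
  by rewrite size_takel // size_tuple ltnW.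
rewrite size_cat sz_k size_tuple leq_addr take_size_cat ?size_tuple // encodeK //.
rewrite addKn addn1.
by rewrite (take_nth false) ?size_tuple // rcons_cat.
Qed.

Lemma converse_exec x w i cs acc k h :
  h i = acc ->
  coord_exec (P := P) x w h (converse i cs acc k) =
    let t := channel x w i cs acc in
    let r := coord_exec (P := P) x w (fun j => if j == i then t else h j) (k t) in
    (r.1, size cs + r.2)%N.
Proof.
elim: cs acc h => [|c cs IH] acc h hi /=.
  rewrite (_ : (fun j => _) = h) -?surjective_pairing //.
  by apply: funext => j; case: eqP => // ->.
rewrite (IH (rcons acc _)) /= ?eqxx hi //.
congr (_, _); rewrite ?addSn; last first.
  by congr (_ + _).+1; congr (coord_exec _ _ _ _).2; apply: funext => j; case: eqP.
by congr (coord_exec _ _ _ _).1; apply: funext => j; case: eqP.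
Qed.

(** Induction on [l], with [U] accumulating the spans received. Distinct servers keep the channels
    still to be polled empty. *)
Lemma poll_exec x w (v : W) (l : seq 'I_s) (U : 'M[F v]_(d + 1)) h :
  uniq l -> (forall i, i \in l -> h i = [::]) ->
  coord_exec (P := P) x w h (poll l U) =
    (~~ (absurd_row (F v) d <= U + \sum_(i <- l) row_span (F v) (x i))%MS,
     size l * (ell + msg_len))%N.
Proof.
elim: l U h => [|i l IH] U h /=.
  by rewrite big_nil addsmx0.
case/andP=> i_l uniq_l h0.
rewrite converse_exec ?h0 ?mem_head // channel_cat.
rewrite (@channel_coordinator _ _ _ (encode ell v) [::]) ?size_tuple // cat0s.
rewrite channel_server // take_oversize ?size_tuple //.
rewrite /= drop_size_cat ?size_tuple //.
rewrite encodeK /=; last exact: card_mx_le.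
rewrite IH //=.
  by rewrite big_cons addsmxA mulSn.
move=> j j_l; rewrite h0 ?in_cons ?j_l ?orbT //.
by case: eqP j_l i_l => // -> ->.
Qed.

Lemma span_protocol_run x (w : {ffun option 'I_s -> W}) :
  coord_run (P := span_protocol) x w =
    (~~ (absurd_row (F (w None)) d <=
          \sum_(i <- enum 'I_s) row_span (F (w None)) (x i))%MS,
     s * (ell + msg_len))%N.
Proof.
by rewrite /coord_run poll_exec ?enum_uniq // size_enum_ord adds0mx.
Qed.

End CoordinatorProtocol.

(** * The blackboard protocol *)

(** The default 0 occurs only when S is contained in U. *)
Definition fresh_row (F : finFieldType) (n : nat) (U S : 'M[F]_n) : 'rV[F]_n :=
  odflt 0 [pick r : 'rV[F]_n | (r <= S)%MS && ~~ (r <= U)%MS].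

Lemma fresh_rowP (F : finFieldType) (n : nat) (U S : 'M[F]_n) :
  ~~ (S <= U)%MS -> (fresh_row U S <= S)%MS && ~~ (fresh_row U S <= U)%MS.
Proof.
rewrite /fresh_row; case: pickP => // none /row_subPn[i nU].
by have := none (row i S); rewrite row_sub nU.
Qed.

Section BlackboardProtocol.
Variables (s d ell : nat) (W : finType) (F : W -> finFieldType).
Hypothesis card_W : (#|W| <= 2 ^ ell)%N.
Hypothesis card_F : forall w, (#|F w| <= 2 ^ ell)%N.

Local Notation tree := (bb_tree s (subsystem d) W).
Local Notation row_len := (1 * (d + 1) * ell)%N.

(** The continuation receives the written string and not the coins, since the tree may branch only
    on what is on the board. *)
Fixpoint coordinator_writes (f : W -> seq bool) (m : nat) (acc : seq bool)
    (k : seq bool -> tree) : tree :=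
  if m is m'.+1 then
    BBCoordinator (fun w => nth false (f w) (size acc))
      (fun a => coordinator_writes f m' (rcons acc a) k)
  else k acc.

Fixpoint server_writes (i : 'I_s) (f : subsystem d -> seq bool) (m : nat)
    (acc : seq bool) (k : seq bool -> tree) : tree :=
  if m is m'.+1 then
    BBServer i (fun x _ => nth false (f x) (size acc))
      (fun a => server_writes i f m' (rcons acc a) k)
  else k acc.

(** Invariant: [acc] is the part of the message already written and [m] the number of bits left. *)
Lemma coordinator_writes_exec x (w : {ffun option 'I_s -> W}) f m acc k :
  acc = take (size acc) (f (w None)) -> size (f (w None)) = (size acc + m)%N ->
  bb_exec x w (coordinator_writes f m acc k) =
    let r := bb_exec x w (k (f (w None))) in (r.1, m + r.2)%N.
Proof.
elim: m acc => [|m IH] acc defacc size_f /=.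
  by rewrite {1}defacc take_oversize ?size_f ?addn0 // -surjective_pairing.
rewrite IH //= size_rcons ?size_f ?addSnnS //.
by rewrite (take_nth false) ?size_f ?addnS ?ltnS ?leq_addr // -defacc.
Qed.

Lemma server_writes_exec x (w : {ffun option 'I_s -> W}) i f m acc k :
  acc = take (size acc) (f (x i)) -> size (f (x i)) = (size acc + m)%N ->
  bb_exec x w (server_writes i f m acc k) =
    let r := bb_exec x w (k (f (x i))) in (r.1, m + r.2)%N.
Proof.
elim: m acc => [|m IH] acc defacc size_f /=.
  by rewrite {1}defacc take_oversize ?size_f ?addn0 // -surjective_pairing.
rewrite IH //= size_rcons ?size_f ?addSnnS //.
by rewrite (take_nth false) ?size_f ?addnS ?ltnS ?leq_addr // -defacc.
Qed.

(* [U] is the span of the rows written so far and [l] the servers that have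
   not yet declared that they hold no row outside it.  Every round shortens [l]
   or raises the rank of [U], which bounds the fuel. *)
Fixpoint rounds (w : W) (fuel : nat) (l : seq 'I_s) (U : 'M[F w]_(d + 1)) : tree :=
  match fuel, l with
  | fuel'.+1, i :: l' =>
      BBServer i (fun x _ => ~~ (row_span (F w) x <= U)%MS)
        (fun fresh =>
           if fresh then
             server_writes i
               (fun x => encode row_len (fresh_row U (row_span (F w) x)))
               row_len [::]
               (fun c => rounds fuel' l
                  (U + odflt 0 (decode 'rV[F w]_(d + 1) row_len c))%MS)
           else rounds fuel' l' U)
  | _, _ => BBReport s (subsystem d) (fun=> ~~ (absurd_row (F w) d <= U)%MS)
  end.

(** Amortized count: a refusal costs one bit and removes a server; a fresh row costs 1 + [row_len]
    bits and raises the rank of U, which is at most d+1. *)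
Lemma rounds_exec x w (v : W) fuel (l : seq 'I_s) (U : 'M[F v]_(d + 1)) :
    (size l + (d + 1 - \rank U) <= fuel)%N ->
  let r := bb_exec x w (rounds fuel l U) in
  r.1 = ~~ (absurd_row (F v) d <= U + \sum_(i <- l) row_span (F v) (x i))%MS /\
  (r.2 <= size l + (d + 1 - \rank U) * (1 + row_len))%N.
Proof.
elim: fuel l U => [|fuel IH] [|i l] U //=; rewrite ?big_nil ?addsmx0 // => lefuel.
have [xU | /= xU] := boolP (row_span (F v) (x i) <= U)%MS.
  have [-> le2] := IH l U ltac:(by rewrite -ltnS).
  split; last by rewrite addSn ltnS.
  by rewrite big_cons addsmxA (adds_eqmx (addsmx_idPl xU) (eqmx_refl _)).
rewrite server_writes_exec ?size_tuple ?take0 //= encodeK; last exact: card_mx_le.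
have /andP[vx vU] := fresh_rowP xU; set u := fresh_row _ _ in vx vU *.
have ltU : (\rank U < \rank (U + u)%MS)%N.
  rewrite ltn_neqAle mxrankS ?addsmxSl // andbT.
  apply: contra vU => /eqP eqr.
  have [_] := mxrank_leqif_eq (addsmxSl U u); rewrite eqr eqxx.
  by case/esym/andP=> _; apply: submx_trans (addsmxSr U u).
have leU : (\rank (U + u)%MS <= d + 1)%N by exact: rank_leq_col.
have [-> le2] := IH (i :: l) (U + u)%MS ltac:(by move: lefuel => /=; lia).
split.
  rewrite !big_cons !addsmxA; congr (~~ _).
  (* The written row already belongs to the span of server [i], which is still in the list, so the
     final sum is unchanged. *)
  have uU : (U + u + row_span (F v) (x i) :=: U + row_span (F v) (x i))%MS.
    apply/eqmxP/andP; split; last by rewrite addsmxS ?addsmxSl.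
    by rewrite !addsmx_sub addsmxSl addsmxSr (submx_trans vx) ?addsmxSr.
  by rewrite (adds_eqmx uU (eqmx_refl _)).
move: le2 => /=; set q := \rank (U + u)%MS in ltU leU *; set r := _.2 => le2.
have -> : (d + 1 - \rank U = (d + 1 - q) + (q - \rank U))%N by lia.
have : (1 + row_len <= (q - \rank U) * (1 + row_len))%N by rewrite leq_pmull // subn_gt0.
by rewrite mulnDl; move: le2; set z := ((d + 1 - q) * _)%N; lia.
Qed.

(** The fuel s + (d+1) is the number of servers plus the codimension of the initial zero span. *)
Definition fresh_row_protocol : bb_protocol s (subsystem d) :=
  {| bb_coins := W;
     bb_root := coordinator_writes (fun w => encode ell w) ell [::]
       (fun c => if decode W ell c is Some w
                 then rounds (s + (d + 1)) (enum 'I_s) (0 : 'M[F w]_(d + 1))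
                 else BBReport s (subsystem d) (fun=> false)) |}.

Lemma fresh_row_protocol_run x (w : {ffun option 'I_s -> W}) :
  let r := bb_run (P := fresh_row_protocol) x w in
  r.1 = ~~ (absurd_row (F (w None)) d <=
              \sum_(i <- enum 'I_s) row_span (F (w None)) (x i))%MS /\
  (r.2 <= ell + (s + (d + 1) * (1 + row_len)))%N.
Proof.
rewrite /bb_run /= coordinator_writes_exec ?size_tuple ?take0 //= encodeK //.
have := @rounds_exec x w (w None) (s + (d + 1)) (enum 'I_s) 0.
rewrite mxrank0 subn0 size_enum_ord => /(_ (leqnn _)) [-> le2].
by rewrite adds0mx leq_add2l.
Qed.

End BlackboardProtocol.

(** * Random primes and error probability *)

(** One coordinate of a uniform function is uniform: the event is a product set, constrained at [i]
    only. *)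
Lemma card_ffun_coord (I W : finType) (i : I) (E : pred W) :
  (#|[pred w : {ffun I -> W} | E (w i)]| * #|W| = #|E| * #|{ffun I -> W}|)%N.
Proof.
pose G j : pred W := if j == i then E else predT.
have -> : #|[pred w : {ffun I -> W} | E (w i)]| =
          #|(family G : simpl_pred {ffun I -> W})|.
  apply: eq_card => w; apply/idP/familyP => [Ew j | /(_ i)].
    by rewrite /G; case: eqP => [->|_].
  by rewrite /G eqxx.
rewrite card_family card_ffun foldrE big_map big_enum /= (bigD1 i) //=.
rewrite -prod_nat_const [in RHS](bigD1 i) //= {1}/G eqxx.
have -> : (\prod_(j | j != i) #|G j| = \prod_(j | j != i) #|W|)%N.
  by apply: eq_bigr => j /negbTE ji; rewrite /G ji.
by rewrite mulnAC mulnA.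
Qed.

Lemma uniform_prob_coord (R : realType) (I W : finType) (i : I) (E : pred W) :
  (0 < #|W|)%N -> uniform_prob R [pred w : {ffun I -> W} | E (w i)] = uniform_prob R E.
Proof.
move=> W_gt0; apply/eqP; rewrite /uniform_prob eqr_div ?pnatr_eq0 -?lt0n //.
  by rewrite -!natrM card_ffun_coord.
by rewrite card_ffun expn_gt0 W_gt0.
Qed.

(** Crude, but it bounds the minor by 2^((d+L)(d+1)), hence its number of prime factors by
    (d+L)(d+1). *)
Lemma fact_le_exp2 d : ((d.+1)`! <= 2 ^ (d * d.+1))%N.
Proof.
elim: d => [|d IH] //; rewrite factS.
apply: leq_trans (leq_mul (ltn_expl d.+1 (ltnSn 1)) IH) _.
by rewrite -expnD leq_exp2l //; lia.
Qed.

Section RandomPrime.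
Variables (K : nat) (pr : 'I_K -> nat).
Hypothesis pr_prime : forall w, prime (pr w).
Hypothesis pr_inj : injective pr.

Lemma card_dvd_primes D : (0 < D)%N ->
  (#|[pred w | pr w %| D]| <= size (primes D))%N.
Proof.
move=> D_gt0; rewrite cardE -(size_map pr); apply: uniq_leq_size.
  by rewrite map_inj_uniq ?enum_uniq.
move=> p /mapP[w]; rewrite mem_enum => /= wD ->.
by rewrite mem_primes pr_prime D_gt0.
Qed.

(** The error analysis shared by both protocols: the answer is right unless the prime divides the
    certifying minor, which happens for at most one index in a hundred. *)
Lemma span_test_feasibility (R : realType) (s d L : nat)
    (run : ('I_s -> subsystem d) -> {ffun option 'I_s -> 'I_K} -> bool * nat) :
    (100 * ((d + L) * d.+1) <= K)%N -> (0 < K)%N ->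
    (forall x w, (run x w).1 =
      ~~ (absurd_row 'F_(pr (w None)) d <=
            \sum_(i <- enum 'I_s) row_span 'F_(pr (w None)) (x i))%MS) ->
  tests_feasibility L run (99%:R / 100%:R : R).
Proof.
move=> leK K_gt0 runE n A b part bndA bndb.
have [D [D_gt0 leD testD]] := feasible_mod_prime R bndA bndb.
pose bad : pred 'I_K := fun w => (pr w %| D)%N.
have bad_le : (#|bad| <= (d + L) * d.+1)%N.
  apply: leq_trans (card_dvd_primes D_gt0) _.
  rewrite -(leq_exp2l (m := 2)) // (leq_trans (size_primes_le D_gt0)) //.
  apply: leq_trans leD _; rewrite mulnDl expnD -expnM leq_mul2r.
  by rewrite fact_le_exp2 orbT.
pose good := [pred w : {ffun option 'I_s -> 'I_K} | predC bad (w None)].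
apply: le_trans (_ : _ <= uniform_prob R good) _.
  rewrite uniform_prob_coord ?card_ord // /uniform_prob card_ord.
  rewrite ler_pdivrMr ?ltr0n // mulrAC ler_pdivlMr ?ltr0n //.
  rewrite -!natrM ler_nat.
  have : (#|bad| + #|predC bad| = K)%N by rewrite -[RHS](card_ord K) -(cardC bad).
  by set c := #|predC bad|; lia.
rewrite /uniform_prob ler_wpM2r ?invr_ge0 ?ler0n // ler_nat.
apply: subset_leq_card; apply/fintype.subsetP => w; rewrite !inE => w_good.
by rewrite runE row_span_held_by testD.
Qed.

End RandomPrime.

(** * Choice of parameters and final bounds *)

Lemma many_primes t :
  (2 ^ (2 * t + 9) <= size (primes_upto (2 ^ (4 * t + 20))))%N.
Proof.
have := size_primes_upto_ge (4 * t + 19).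
have -> : ((4 * t + 19).+1 = 4 * t + 20)%N by lia.
set N := size _ => leN.
(* The logarithmic loss in Chebyshev's estimate is absorbed by giving up 2t+10 of the 4t+19 bits. *)
have le_ell : (4 * t + 20 <= 2 ^ (2 * t + 10))%N.
  have lt_t : (t.+1 <= 2 ^ (2 * t))%N.
    by apply: leq_trans (ltn_expl t (ltnSn 1)) _; rewrite leq_exp2l //; lia.
  by rewrite expnD; lia.
rewrite -(leq_pmul2l (m := 2 ^ (2 * t + 10))) ?expn_gt0 // -expnD.
have -> : (2 * t + 10 + (2 * t + 9) = 4 * t + 19)%N by lia.
by rewrite (leq_trans leN) // leq_mul2r le_ell orbT.
Qed.

(** Rounding up at most doubles log_2 m: with t the rounded value, both 2^(t-1) and 2 are at most
    m. *)
Lemma up_log_ln (R : realType) (m : nat) : (2 <= m)%N ->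
  (up_log 2 m)%:R * ln 2%:R <= 2%:R * ln m%:R :> R.
Proof.
move=> m_ge2; have /andP[lt_m _] := up_log_bounds (ltnSn 1) m_ge2.
set t := up_log 2 m in lt_m *.
have t_gt0 : (0 < t)%N by rewrite up_log_gt0.
rewrite -(prednK t_gt0) -natr1 mulrDl mul1r mulrDl mul1r lerD //.
  rewrite mulr_natl -lnXn ?ltr0n // ler_ln ?posrE ?exprn_gt0 ?ltr0n //; last by lia.
  by rewrite -natrX ler_nat ltnW.
by rewrite ler_ln ?posrE ?ltr0n // ?ler_nat //; lia.
Qed.

Theorem theorem4p2 (R : realType) :
  exists C : R, 0 < C /\
    forall s d L : nat, (2 <= s)%N -> (1 <= d)%N -> (1 <= L)%N ->
      (exists P : coord_protocol s (subsystem d),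
          tests_feasibility L (coord_run (P := P)) (99%:R / 100%:R : R) /\
          communication_at_most L (coord_run (P := P))
            (C * (s%:R * d%:R ^+ 2 * log_dL R d L))) /\
      (exists P : bb_protocol s (subsystem d),
          tests_feasibility L (bb_run (P := P)) (99%:R / 100%:R : R) /\
          communication_at_most L (bb_run (P := P))
            (C * (s%:R + d%:R ^+ 2 * log_dL R d L))).
Proof.
have ln2_gt0 : 0 < ln 2%:R :> R by rewrite ln_gt0 // ltr1n.
(* Here 336 = 7 * 48: the relevant bit counts are at most 7 d^2 [ell], and [ell] <= 24 t <= 48 log_2
   (max(2, dL)). The summand 1 pays for the s refusals on the blackboard. *)
exists (336%:R / ln 2%:R + 1); split; first by rewrite addr_gt0 // divr_gt0 ?ltr0n.
move=> s d L _ d_gt0 L_gt0.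
pose m := maxn 2 (d * L); pose t := up_log 2 m.
have m_ge2 : (2 <= m)%N by rewrite leq_maxl.
have t_gt0 : (0 < t)%N by rewrite up_log_gt0.
(* K >= 100 (d + L) (d + 1), and there are at least K primes below 2^ell. *)
pose K := (2 ^ (2 * t + 9))%N; pose ell := (4 * t + 20)%N.
have K_gt0 : (0 < K)%N by rewrite expn_gt0.
pose ps := primes_upto (2 ^ ell).
pose pr (w : 'I_K) := nth 0%N ps w.
have lt_ps (w : 'I_K) : (w < size ps)%N by exact: leq_trans (ltn_ord w) (many_primes t).
have pr_ps w : prime (pr w) && (pr w <= 2 ^ ell)%N.
  by rewrite -mem_primes_upto mem_nth.
have pr_prime w : prime (pr w) by case/andP: (pr_ps w).
have pr_inj : injective pr.
  move=> u v /eqP; rewrite nth_uniq ?primes_upto_uniq // => /eqP; exact: val_inj.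
pose F (w : 'I_K) : finFieldType := 'F_(pr w).
have card_W : (#|'I_K| <= 2 ^ ell)%N by rewrite card_ord leq_exp2l // /ell; lia.
have card_F w : (#|F w| <= 2 ^ ell)%N.
  by rewrite card_Fp //; case/andP: (pr_ps w).
have leK : (100 * ((d + L) * d.+1) <= K)%N.
  have m_le : (d * L <= 2 ^ t)%N by apply: leq_trans (up_logP m (ltnSn 1)); rewrite leq_maxr.
  (* As d, L >= 1, both are at most dL <= 2^t; then 100 (d+L)(d+1) <= 400 * 4^t, below K = 512 *
     4^t. *)
  have h1 : (d.+1 <= 2 * 2 ^ t)%N by nia.
  have h2 : (d + L <= 2 * 2 ^ t)%N by nia.
  have := leq_mul h2 h1; rewrite mulnACA -expnD addnn -mul2n /K expnD.
  by rewrite -[(2 ^ 9)%N]/512%N; lia.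
have ell_ln : ell%:R <= 48%:R / ln 2%:R * log_dL R d L.
  rewrite mulrAC ler_pdivlMr //.
  apply: le_trans (_ : (24%:R * t%:R) * ln 2%:R <= _).
    by rewrite ler_wpM2r ?(ltW ln2_gt0) // -natrM ler_nat /ell; lia.
  rewrite -mulrA -[48%:R]/((24 * 2)%:R) natrM -mulrA ler_wpM2l ?ler0n //.
  exact: up_log_ln.
have log_ge0 : 0 <= log_dL R d L by rewrite ln_ge0 // ler1n; lia.
have bound (q : nat) : (q <= 7 * (d ^ 2 * ell))%N ->
    q%:R <= 336%:R / ln 2%:R * (d%:R ^+ 2 * log_dL R d L).
  rewrite -(ler_nat R) => /le_trans; apply.
  rewrite (natrM _ 7) (natrM _ (d ^ 2)) natrX mulrCA [leRHS]mulrCA.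
  rewrite ler_wpM2l ?exprn_ge0 ?ler0n //.
  rewrite -[336%:R]/((7 * 48)%:R) natrM -!mulrA ler_wpM2l ?ler0n // mulrA.
  exact: ell_ln.
split.
  exists (span_protocol s d ell F); split.
    apply: (@span_test_feasibility _ _ pr_prime pr_inj R s d L
              (coord_run (P := span_protocol s d ell F)) leK K_gt0) => x w.
    by rewrite span_protocol_run.
  move=> n A b part w _ _; rewrite span_protocol_run //= natrM.
  rewrite -(mulrA s%:R) mulrCA.
  rewrite ler_wpM2l ?ler0n // mulrDl (le_trans (bound _ _)) //.
    nia.
  by rewrite lerDl mul1r mulr_ge0 // exprn_ge0.
exists (fresh_row_protocol s d ell F); split.
  apply: (@span_test_feasibility _ _ pr_prime pr_inj R s d L
            (bb_run (P := fresh_row_protocol s d ell F)) leK K_gt0) => x w.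
  by have [] := fresh_row_protocol_run card_W card_F x w.
move=> n A b part w _ _.
have [_] := fresh_row_protocol_run card_W card_F (held_by A b part) w.
rewrite -(ler_nat R) => /le_trans; apply.
rewrite addnCA natrD mulrDr lerD //.
  by rewrite mulrDl mul1r lerDr mulr_ge0 ?ler0n // divr_ge0 ?ler0n // ltW.
rewrite mulrDl (le_trans (bound _ _)) //.
  nia.
by rewrite lerDl mul1r mulr_ge0 // exprn_ge0.
Qed.
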